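(* Let $m\ge 1$ be an integer and $0<\varepsilon\le 1$. For the problem $P_m|\varepsilon,\mathrm{online},pmtn|\sum p_j(1-U_j)$ (online maximization of total accepted processing time on $m$ parallel identical machines, with preemption and migration, commitment on acceptance, and slack factor $\varepsilon$), the strict competitive ratio of any deterministic online algorithm is at least $$\frac{\lfloor m(1+\varepsilon)\rfloor}{\varepsilon\cdot\sum_{i=0}^{m-1}\left(\frac{1+\varepsilon}{\varepsilon}\right)^{\frac im}}=\lfloor m(1+\varepsilon)\rfloor\cdot\left(\left(\frac{1+\varepsilon}{\varepsilon}\right)^{\frac1m}-1\right).$$
   Context: Problem. There are $m$ parallel identical machines and a finite sequence $\mathcal{J}$ of jobs. Job $J_j$ has release (submission) date $r_j\ge 0$, processing time $p_j>0$ and deadline $d_j$ satisfying the slack condition $d_j-r_j\ge(1+\varepsilon)p_j$. The sequence is ordered so that $J_i$ precedes $J_j$ whenever $r_i<r_j$ (several jobs may have the same release date). Jobs are revealed in sequence order; job $J_j$ becomes known at time $r_j$, and the online algorithm must decide immediately, before seeing any later job of the sequence, whether to accept it ($U_j=0$) or reject it ($U_j=1$). The decision is irrevocable, and every accepted job must be processed completely within $[r_j,d_j]$. Preemption: a job in execution may be interrupted at any time and resumed immediately or later, possibly on a different machine, without penalty; at any time a machine processes at most one job and a job is processed on at most one machine. The online algorithm may choose and modify the future schedule of accepted jobs over time, provided all accepted jobs meet their deadlines. The objective is to maximize $\sum_j p_j(1-U_j)$. Let $\mathrm{ALG}(\mathcal{J})$ be the objective value of the online algorithm and $\mathrm{OPT}(\mathcal{J})$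 the optimal offline value, i.e. the maximum total processing time of a subset of the jobs of $\mathcal{J}$ that has a preemptive schedule (with migration) on $m$ machines completing each job of the subset between its release date and its deadline. The algorithm has strict competitive ratio (at most) $c_{ALG}$ if $\mathrm{OPT}(\mathcal{J})\le c_{ALG}\cdot\mathrm{ALG}(\mathcal{J})$ for every job sequence $\mathcal{J}$ satisfying the slack condition; a number $c$ is a lower bound if $c\le c_{ALG}$ for every deterministic online algorithm and every such $c_{ALG}$ for it. *)

(* Defs.v *)
From HB Require Import structures.
From mathcomp Require Import all_boot all_order all_algebra.
From mathcomp Require Import all_classical all_reals all_analysis.

Set Implicit Arguments.
Unset Strict Implicit.
Unset Printing Implicit Defensive.

Import Order.TTheory GRing.Theory Num.Theory.

Local Open Scope ring_scope.

Record job (R : realType) : Type := Job {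
  release : R;
  processing : R;
  deadline : R
}.

Definition job_at (R : realType) (J : seq (job R)) (j : 'I_(size J)) : job R :=
  tnth (in_tuple J) j.

Definition instance (R : realType) (eps : R) (J : seq (job R)) : Prop :=
  sorted (fun a b : job R => release a <= release b) J /\
  forall j : 'I_(size J),
    [/\ 0 <= release (job_at j),
        0 < processing (job_at j) &
        (1 + eps) * processing (job_at j)
          <= deadline (job_at j) - release (job_at j)].

(* [S i t = Some k]: machine [i] processes the job at position [k] of the
   sequence at time [t]; [S i t = None]: machine [i] is idle at time [t].
   That a machine handles at most one job at a time is built into the type. *)
Definition schedule (R : realType) (m : nat) : Type := 'I_m -> R -> option nat.

(* [S] processes exactly the jobs of [A], each of them completely and inside
   its own window. The processing a job receives is the Lebesgue measure of the
   times at which it runs, so preemption and migration are unrestricted. *)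
Definition feasible (R : realType) (m : nat) (J : seq (job R))
    (A : {set 'I_(size J)}) (S : schedule R m) : Prop :=
  [/\ forall (i : 'I_m) (k : nat), measurable [set t : R | S i t = Some k]%classic,
      forall (i : 'I_m) (t : R) (k : nat), S i t = Some k ->
        exists j : 'I_(size J),
          [/\ k = j, j \in A & release (job_at j) <= t <= deadline (job_at j)],
      forall (i i' : 'I_m) (t : R) (k : nat),
        S i t = Some k -> S i' t = Some k -> i = i' &
      forall j : 'I_(size J), j \in A ->
        (\sum_(i < m) lebesgue_measure [set t : R | S i t = Some (j : nat)]%classic
           = (processing (job_at j))%:E)%E].

Definition load (R : realType) (J : seq (job R)) (A : {set 'I_(size J)}) : R :=
  \sum_(j in A) processing (job_at j).

(* The empty set of jobs is feasible and loads are nonnegative on instances, so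
   the base value [0] of the maximum is harmless. *)
Definition OPT (R : realType) (m : nat) (J : seq (job R)) : R :=
  \big[Num.max/0]_(A : {set 'I_(size J)} |
      `[< exists S : schedule R m, feasible A S >]) load A.

(* [accept h a]: is job [a] accepted when [h] is the sequence of the jobs
   preceding it? [run h t i]: position in the sequence of the job processed by
   machine [i] at time [t] when [h] is the sequence of the jobs known at time
   [t]. The earlier decisions are functions of [h], hence not arguments. *)
Record online_algorithm (R : realType) (m : nat) : Type := OnlineAlgorithm {
  accept : seq (job R) -> job R -> bool;
  run : seq (job R) -> R -> 'I_m -> option nat
}.

Definition accepted (R : realType) (m : nat) (alg : online_algorithm R m)
    (J : seq (job R)) : {set 'I_(size J)} :=
  [set j : 'I_(size J) | accept alg (take j J) (job_at j)]%SET.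

(* The jobs of an instance known at time [t] form a prefix of it, so that
   positions in that prefix are positions in [J]. *)
Definition executed (R : realType) (m : nat) (alg : online_algorithm R m)
    (J : seq (job R)) : schedule R m :=
  fun i t => run alg [seq a <- J | release a <= t] t i.

Definition meets_commitments (R : realType) (m : nat) (eps : R)
    (alg : online_algorithm R m) : Prop :=
  forall J : seq (job R), instance eps J ->
    feasible (accepted alg J) (executed alg J).

Definition ALG (R : realType) (m : nat) (alg : online_algorithm R m)
    (J : seq (job R)) : R :=
  load (accepted alg J).

Definition strictly_competitive (R : realType) (m : nat) (eps : R)
    (alg : online_algorithm R m) (c : R) : Prop :=
  forall J : seq (job R), instance eps J -> OPT m J <= c * ALG alg J.

(* Main.v *)
(* All jobs are released at time 0 with the tight deadline [(1 + eps) * p]. Put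
   [K = floor (m (1 + eps))] and suppose [c < K (g - 1)] with [g] slightly below
   [f = ((1 + eps) / eps) ^ (1 / m)]. The adversary first submits [K] unit jobs;
   let [S] be the accepted load, so that [K <= c S] and hence [(g - 1) S > 1].
   Then it repeats [m] times: when the accepted load is [L], it submits copies of
   a job of size [y = (g - 1) L] until one is accepted. This happens within [K]
   copies, because [K] copies fit on [m] machines (McNaughton) and [c L < K y].
   Every round multiplies the load by [g]. A job of size [y >= 1] needs at least
   [1 + eps - eps y] units of processing before time [1 + eps], so the capacity of
   the machines up to that time gives
   [S + m (1 + eps) - eps (g ^ m S - S) <= m (1 + eps)], that is
   [1 + eps <= eps g ^ m], which contradicts [g < f]. *)

Require Import Defs.
From HB Require Import structures.
From mathcomp Require Import all_boot all_order all_algebra.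
From mathcomp Require Import all_classical all_reals all_analysis.
From mathcomp Require Import lra.

Import Order.TTheory GRing.Theory Num.Theory.

Local Open Scope ring_scope.

(** * Machine capacity before a given time *)

(** By disjointness the sum is the measure of a union contained in [[a, b]]. It serves both for one
    job across machines and for one machine across jobs. *)
Lemma sum_measure_le (R : realType) (n : nat) (P : pred 'I_n)
    (F : 'I_n -> set R) (a b : R) :
  a <= b ->
  (forall i, P i -> measurable (F i)) ->
  (forall i, P i -> F i `<=` `[a, b])%classic ->
  (forall i j x, P i -> P j -> F i x -> F j x -> i = j) ->
  (\sum_(i < n | P i) lebesgue_measure (F i) <= (b - a)%:E)%E.
Proof.
move=> ab mF sF dF; rewrite -measure_bigsetU_ord_cond //; last first.
  by move=> i j Pi Pj [x [Fi Fj]]; exact: dF Pi Pj Fi Fj.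
apply: (@le_trans _ _ (lebesgue_measure `[a, b]%classic)).
  apply: le_measure; rewrite ?inE //.
  - exact: bigsetU_measurable.
  - apply: (big_ind (fun X => X `<=` `[a, b])%classic) => //.
    by move=> X Y XI YI x [/XI|/YI].
by rewrite lebesgue_measure_itv /= lte_fin; case: ifP => //; rewrite lee_fin subr_ge0.
Qed.

(* At most [deadline - T] of a job can be postponed beyond time [T]. *)
Lemma work_before_le (R : realType) (m : nat) (J : seq (job R))
    (A : {set 'I_(size J)}) (S : schedule R m) (T : R) :
  feasible A S -> 0 <= T ->
  (forall j, j \in A -> 0 <= release (job_at j)) ->
  (forall j, j \in A -> T <= deadline (job_at j)) ->
  \sum_(j in A) (processing (job_at j) - (deadline (job_at j) - T)) <= m%:R * T.
Proof.
move=> [mS winS injS pS] T0 rel0 Tdl.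
pose X i (j : 'I_(size J)) : set R := [set t | S i t = Some (j : nat)]%classic.
have early j : j \in A ->
    ((processing (job_at j) - (deadline (job_at j) - T))%:E
      <= \sum_(i < m) lebesgue_measure (X i j `&` `[0%R, T]%classic))%E.
  move=> jA; rewrite EFinB leeBlDr // -pS //.
  (* A job never runs on two machines at once, so its late pieces are disjoint and total at most
     [deadline - T]. *)
  pose late i := (X i j `&` `[T, deadline (job_at j)])%classic.
  apply: (@le_trans _ _ (\sum_(i < m) (lebesgue_measure (X i j `&` `[0%R, T]%classic)
                           + lebesgue_measure (late i)))%E).
    apply: lee_sum => i _.
    have mXI a b : measurable (X i j `&` `[a, b])%classic.
      by apply: measurableI; [exact: mS|exact: measurable_itv].
    apply: le_trans (measureU2 lebesgue_measure (mXI 0 T) (mXI T _)).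
    apply: le_measure; rewrite ?inE; [exact: mS|by apply: measurableU; exact: mXI|].
    move=> t Xt; have [k [/ord_inj ? _]] := winS _ _ _ Xt; subst k.
    move=> /andP[rt td]; have {}rt := le_trans (rel0 _ jA) rt.
    by case: (leP t T) => tT; [left|right]; split=> //=; rewrite in_itv /= ?rt ?tT ?(ltW tT).
  rewrite big_split /=; apply: leeD => //.
  apply: (@sum_measure_le _ _ predT) => // [|i _|i _|i i' t _ _ [+ _] [+ _]].
  - exact: Tdl.
  - by apply: measurableI; [exact: mS|exact: measurable_itv].
  - by move=> t [].
  - exact: injS.
rewrite -lee_fin -sumEFin; apply: le_trans (lee_sum _ early) _.
(* Summing per machine instead: distinct jobs occupy disjoint subsets of [[0, T]]. *)
rewrite exchange_big /= mulr_natl -[m in T *+ m]card_ord -sumr_const -sumEFin.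
apply: lee_sum => i _; rewrite -[T in leRHS]subr0.
apply: sum_measure_le => // [j jA|j j' t _ _ [+ _] [+ _]].
- by apply: measurableI; [exact: mS|exact: measurable_itv].
- by rewrite /X /= => -> [] /ord_inj.
Qed.

(** * Tight jobs and McNaughton's schedule *)

Definition tight_job {R : realType} (eps p : R) : job R := Job 0 p ((1 + eps) * p).

(* McNaughton's wrap-around rule: [K] jobs of size [y] laid end to end on a line
   of which machine [i] owns the piece [[i * T, (i + 1) * T)]; positions are
   shifted by [n0]. *)
Definition wrap_around {R : realType} {m : nat} (n0 K : nat) (y T : R) : schedule R m :=
  fun i t => let q := Num.truncn ((i%:R * T + t) / y) in
    if (0 <= t < T) && (q < K)%N then Some (n0 + q)%N else None.

Lemma wrap_aroundP {R : realType} {m n0 K k : nat} {y T t : R} {i : 'I_m} :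
  0 < y -> wrap_around n0 K y T i t = Some k <->
  exists q : nat, [/\ k = (n0 + q)%N, (q < K)%N, 0 <= t < T &
    q%:R * y <= i%:R * T + t < q.+1%:R * y].
Proof.
move=> y0; rewrite /wrap_around; set x := (_ / y).
have qE (q : nat) : 0 <= t < T ->
    (Num.truncn x == q) = (q%:R * y <= i%:R * T + t < q.+1%:R * y).
  move=> /andP[t0 tT]; rewrite truncn_eq; first by rewrite ler_pdivlMr // ltr_pdivrMr.
  by rewrite divr_ge0 ?(ltW y0) // addr_ge0 // mulr_ge0 // (le_trans t0) // ltW.
split=> [|[q [-> qK tT]]]; last by rewrite -qE // tT => /eqP ->; rewrite qK.
case: ifP => // /andP[tT qK] [<-]; exists (Num.truncn x); split => //.
by rewrite -qE.
Qed.

(** At time [t] two machines own positions at least [T] apart, whereas a job fills a half-open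
    interval of length [y <= T]. *)
Lemma wrap_around_inj (R : realType) (m n0 K k : nat) (y T t : R) (i i' : 'I_m) :
  0 < y -> y <= T -> wrap_around n0 K y T i t = Some k ->
  wrap_around n0 K y T i' t = Some k -> i = i'.
Proof.
move=> y0 yT /(wrap_aroundP y0)[q [kq _ _ /andP[lo hi]]].
move=> /(wrap_aroundP y0)[q' [kq' _ _]].
have <- : q = q' by move: kq'; rewrite kq => /eqP; rewrite eqn_add2l => /eqP.
move=> /andP[lo' hi']; move: hi hi'; rewrite -natr1 mulrDl mul1r => hi hi'.
have T0 : 0 < T := lt_le_trans y0 yT.
have sep (a b : nat) : (a < b)%N -> a%:R * T + T <= b%:R * T :> R.
  by move=> ab; rewrite -{2}[T]mul1r -mulrDl ler_pM2r // natr1 ler_nat.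
by case: (ltngtP i i') => [/sep|/sep|/ord_inj //] ?; exfalso; lra.
Qed.

(** The left side is the length of the intersection of [[s, t[] and [[a, b[]. As a difference of
    clamped endpoints it telescopes over consecutive pieces. *)
Lemma clip_diff (R : realFieldType) (a b s t : R) : a <= b -> s <= t ->
  (if Num.max s a < Num.min t b then Num.min t b - Num.max s a else 0)
  = Num.min (Num.max t a) b - Num.min (Num.max s a) b.
Proof.
move=> ab st; case: (leP s a) => sa; case: (leP t b) => tb.
- rewrite (min_idPl ab); case: (leP t a) => ta /=.
    by rewrite (min_idPl ab) subrr.
  by rewrite (min_idPl tb).
- have at_ : a <= t by apply: le_trans ab (ltW tb).
  rewrite (max_idPl at_) (min_idPl ab) (min_idPr (ltW tb)).
  by case: ltP => //; lra.
- have at_ : a <= t by apply: le_trans st; exact: ltW.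
  rewrite (max_idPl at_) (min_idPl tb) (min_idPl (le_trans st tb)).
  by case: ltP => //; lra.
- have at_ : a <= t by apply: le_trans st; exact: ltW.
  rewrite (max_idPl at_) (min_idPr (ltW tb)).
  by case: (leP s b) => sb; case: ltP => //; lra.
Qed.

Lemma wrap_around_itv (R : realType) (m n0 K q : nat) (y T : R) (i : 'I_m) :
  0 < y -> (q < K)%N ->
  [set t : R | wrap_around n0 K y T i t = Some (n0 + q)%N]%classic =
  `[Num.max (i%:R * T) (q%:R * y) - i%:R * T,
    Num.min (i.+1%:R * T) (q.+1%:R * y) - i%:R * T[%classic.
Proof.
move=> y0 qK; apply/seteqP; split=> t /=;
  rewrite in_itv /= lerBlDl ge_max lerDl ltrBrDl lt_min -natr1 mulrDl mul1r ltrD2l.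
  move=> /(wrap_aroundP y0)[q' [/eqP + _ /andP[t0 tT] /andP[lo hi]]].
  by rewrite eqn_add2l => /eqP ?; subst q'; rewrite t0 lo hi tT.
move=> /andP[/andP[t0 lo] /andP[tT hi]].
by apply/(wrap_aroundP y0); exists q; rewrite t0 tT lo hi.
Qed.

Lemma wrap_around_measure (R : realType) (m n0 K q : nat) (y T : R) :
  0 < y -> 0 <= T -> K%:R * y <= m%:R * T -> (q < K)%N ->
  (\sum_(i < m) lebesgue_measure
     [set t : R | wrap_around n0 K y T i t = Some (n0 + q)%N]%classic = y%:E)%E.
Proof.
move=> y0 T0 KT qK.
pose clip x := Num.min (Num.max x (q%:R * y)) (q.+1%:R * y).
have qy : q%:R * y <= q.+1%:R * y by rewrite ler_pM2r // ler_nat.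
(* The pieces owned by the machines are consecutive, so only [clip (m * T) - clip 0] survives; the
   job lies inside [[0, m * T]], hence the value [y]. *)
transitivity ((\sum_(0 <= i < m) (clip (i.+1%:R * T) - clip (i%:R * T)))%:E).
  rewrite big_mkord -sumEFin; apply: eq_bigr => i _.
  rewrite -clip_diff //; last by rewrite ler_wpM2r // ler_nat.
  rewrite wrap_around_itv //.
  rewrite lebesgue_measure_itv /= lte_fin ltrD2r.
  by case: ifP => // _; rewrite -EFinB; congr (_%:E); lra.
rewrite telescope_sumr // mul0r /clip; congr (_%:E).
have qyK : q.+1%:R * y <= m%:R * T.
  by rewrite (le_trans _ KT) // ler_pM2r // ler_nat.
have qy0 : 0 <= q%:R * y by rewrite mulr_ge0 // ltW.
rewrite (max_idPl (le_trans qy qyK)) (min_idPr qyK) (max_idPr qy0) (min_idPl qy).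
by rewrite -natr1; lra.
Qed.

(** Scheduling only the batch suffices: with [T = (1 + eps) * y] the bound on [K] says that the
    batch fits, [K * y <= m * T]. *)
Lemma OPT_ge_batch (R : realType) (m K : nat) (eps y : R) (J : seq (job R)) :
  0 <= eps -> 0 < y -> K%:R <= m%:R * (1 + eps) ->
  K%:R * y <= OPT m (J ++ nseq K (tight_job eps y)).
Proof.
move=> eps0 y0 Km; set J' := J ++ _; set n0 := size J.
pose T := (1 + eps) * y.
have yT : y <= T by rewrite /T mulrDl mul1r lerDl mulr_ge0 // ltW.
have sJ' : size J' = (n0 + K)%N by rewrite size_cat size_nseq.
have batch (j : 'I_(size J')) : (n0 <= j)%N -> job_at j = tight_job eps y.
  move=> jn; rewrite /job_at (tnth_nth (tight_job eps y)) /= nth_cat ltnNge jn /=.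
  by rewrite nth_nseq if_same.
pose A := [set j : 'I_(size J') | (n0 <= j)%N]%SET.
have -> : K%:R * y = load A.
  rewrite /load (eq_bigr (fun=> y)); last by move=> j; rewrite inE => /batch ->.
  rewrite (eq_bigl (fun j : 'I_(size J') => (n0 <= j)%N)); last by move=> j; rewrite inE.
  rewrite -(big_mkord (fun j => (n0 <= j)%N) (fun=> y)) sJ'.
  rewrite (big_cat_nat (n := n0)) ?leq_addr //= big_nat_cond big_pred0 ?add0r; last first.
    by move=> j; case: (ltnP j n0); rewrite ?andbF ?andbT.
  rewrite big_nat_cond (eq_bigl (fun j => (n0 <= j < n0 + K)%N && true)); last first.
    by move=> j; case: (leqP n0 j); rewrite ?andbF ?andbT.
  by rewrite -big_nat_cond sumr_const_nat addKn mulr_natl.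
rewrite /OPT; apply: le_bigmax_cond; apply/asboolP.
exists (wrap_around n0 K y T); split.
- move=> i k; case: (ltnP k n0) => [kn|nk].
    rewrite (_ : [set _ | _]%classic = set0) //; apply/seteqP; split=> // t /=.
    by move=> /(wrap_aroundP y0)[q [kq]]; rewrite kq ltnNge leq_addr in kn.
  rewrite -(subnKC nk); case: (ltnP (k - n0) K) => [qK|Kq].
    by rewrite wrap_around_itv //; exact: measurable_itv.
  rewrite (_ : [set _ | _]%classic = set0) //; apply/seteqP; split=> // t /=.
  move=> /(wrap_aroundP y0)[q [/eqP]]; rewrite eqn_add2l => /eqP <-.
  by rewrite ltnNge Kq.
- move=> i t k /(wrap_aroundP y0)[q [-> qK /andP[t0 tT] _]].
  have jlt : (n0 + q < size J')%N by rewrite sJ' ltn_add2l.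
  exists (Ordinal jlt); rewrite inE leq_addr batch ?leq_addr //=; split=> //.
  by rewrite t0 ltW.
- by move=> i i' t k; exact: wrap_around_inj.
- move=> j; rewrite inE => nj; rewrite batch //= -[nat_of_ord j](subnKC nj).
  apply: wrap_around_measure => //.
  + by rewrite (le_trans (ltW y0)).
  + by rewrite /T mulrA ler_pM2r.
  + by rewrite ltn_subLR // -sJ'.
Qed.

(** * Accepted weight along a growing sequence *)

(** The weight [F] is arbitrary so that the load and the work due early are tracked by the same
    lemmas. *)
Definition gain {R : realType} {m : nat} (alg : online_algorithm R m)
    (F : job R -> R) (J : seq (job R)) : R :=
  \sum_(j in accepted alg J) F (job_at j).

(** Natural-number indices avoid the type ['I_(size J)], which changes when [J] grows; [a] is only a
    default for [nth]. *)
Lemma gainE (R : realType) (m : nat) (alg : online_algorithm R m)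
    (F : job R -> R) (a : job R) (J : seq (job R)) :
  gain alg F J = \sum_(0 <= k < size J | accept alg (take k J) (nth a J k)) F (nth a J k).
Proof.
rewrite big_mkord /gain; apply: eq_big => [j|j _]; rewrite ?inE /job_at (tnth_nth a) //.
Qed.

(** Each decision depends only on the prefix before the job, so appending [a] leaves the earlier
    ones unchanged. *)
Lemma gain_rcons (R : realType) (m : nat) (alg : online_algorithm R m)
    (F : job R -> R) (J : seq (job R)) (a : job R) :
  gain alg F (rcons J a) = gain alg F J + (if accept alg J a then F a else 0).
Proof.
rewrite !(gainE _ _ _ _ a) size_rcons big_mkcond big_nat_recr //=.
rewrite nth_rcons ltnn eqxx -cats1 take_size_cat // [in RHS]big_mkcond /=.
congr (_ + _); apply: eq_big_nat => k /andP[_ kJ].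
by rewrite nth_cat kJ takel_cat // ltnW.
Qed.

Lemma gain_rejected (R : realType) (m : nat) (alg : online_algorithm R m)
    (F : job R -> R) (J : seq (job R)) (a : job R) (n : nat) :
  (forall k, (k < n)%N -> ~~ accept alg (J ++ nseq k a) a) ->
  gain alg F (J ++ nseq n a) = gain alg F J.
Proof.
elim: n => [_|n IHn rej]; first by rewrite cats0.
rewrite -addn1 nseqD catA cats1 gain_rcons (negPf (rej _ _)) // addr0.
by apply: IHn => k kn; apply: rej; rewrite ltnS ltnW.
Qed.

(** * The adversary *)

Lemma job_at_tight (R : realType) (eps : R) (ps : seq R)
    (j : 'I_(size (map (tight_job eps) ps))) :
  exists2 p, p \in ps & job_at j = tight_job eps p.
Proof.
have jlt : (j < size ps)%N by rewrite -(size_map (tight_job eps)).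
exists (nth 0 ps j); first exact: mem_nth.
by rewrite /job_at (tnth_nth (tight_job eps 0)) (nth_map 0).
Qed.

Lemma instance_tight (R : realType) (eps : R) (ps : seq R) :
  (forall p, p \in ps -> 0 < p) -> instance eps (map (tight_job eps) ps).
Proof.
move=> ps0; split=> [|j].
  by elim: ps {ps0} => //= p [|q ps] //= IHps; apply/andP; split.
have [p /ps0 p0 ->] := job_at_tight _ _ _ j.
by rewrite /= subr0.
Qed.

(* If all [K] copies were rejected, the optimum would be at least [K * y]. *)
Lemma forced_acceptance (R : realType) (m K : nat) (eps c y : R)
    (alg : online_algorithm R m) (ps : seq R) :
  0 <= eps -> K%:R <= m%:R * (1 + eps) -> strictly_competitive eps alg c ->
  (forall p, p \in ps -> 0 < p) -> 0 < y ->
  c * ALG alg (map (tight_job eps) ps) < K%:R * y ->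
  exists n, forall F, gain alg F (map (tight_job eps) (ps ++ nseq n.+1 y))
    = gain alg F (map (tight_job eps) ps) + F (tight_job eps y).
Proof.
move=> eps0 Km comp ps0 y0 big_y.
set J := map _ ps in big_y *; pose a := tight_job eps y.
have JE n : map (tight_job eps) (ps ++ nseq n y) = J ++ nseq n a.
  by rewrite map_cat map_nseq.
have [/existsP[k0 acc0]|/existsPn rej] :=
    boolP [exists k : 'I_K, accept alg (J ++ nseq k a) a].
  have ex : exists k, accept alg (J ++ nseq k a) a by exists k0.
  (* Stop at the first accepted copy: the [n] copies before it are rejected and add nothing. *)
  exists (ex_minn ex) => F; case: ex_minnP => n acc min_n.
  rewrite JE -addn1 nseqD catA cats1 gain_rcons acc gain_rejected // => k kn.
  by apply/negP => /min_n; rewrite leqNgt kn.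
have inst : instance eps (J ++ nseq K a).
  rewrite -JE; apply: instance_tight => p; rewrite mem_cat => /orP[/ps0 //|].
  by rewrite mem_nseq => /andP[_ /eqP ->].
have algE : ALG alg (J ++ nseq K a) = ALG alg J.
  by apply: gain_rejected => k kK; exact: (rej (Ordinal kK)).
have := comp _ inst; rewrite algE leNgt (lt_le_trans big_y) //.
exact: OPT_ge_batch.
Qed.

Lemma adversary (R : realType) (m K : nat) (eps c g : R)
    (alg : online_algorithm R m) :
  0 < eps -> (0 < K)%N -> K%:R <= m%:R * (1 + eps) -> 1 <= g ->
  eps * g ^+ m < 1 + eps -> c < K%:R * (g - 1) ->
  meets_commitments eps alg -> ~ strictly_competitive eps alg c.
Proof.
move=> eps0 K0 Km g1 gm cK meets comp.
pose tight := map (tight_job eps).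
pose S := ALG alg (tight (nseq K 1)).
have KR0 : 0 < K%:R :> R by rewrite ltr0n.
have KcS : K%:R <= c * S.
  have := @OPT_ge_batch _ m K eps 1 [::] (ltW eps0) ltr01 Km.
  rewrite mulr1 /= => /le_trans; apply; rewrite -map_nseq.
  by apply/comp/instance_tight => p; rewrite mem_nseq => /andP[_ /eqP ->].
have S0 : 0 < S.
  rewrite lt_neqAle; apply/andP; split.
    by apply/eqP => S0; move: KcS; rewrite -S0 mulr0 leNgt KR0.
  apply: sumr_ge0 => j _.
  by have [p + ->] := job_at_tight _ _ _ j; rewrite mem_nseq => /andP[_ /eqP ->].
have gS : 1 < (g - 1) * S.
  rewrite -(ltr_pM2l KR0) mulr1 mulrA; apply: le_lt_trans KcS _.
  by rewrite ltr_pM2r.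
(* A lower bound for the work on [a] before [1 + eps], the common deadline of the unit jobs. *)
pose urgent (a : job R) := processing a - (deadline a - (1 + eps)).
(* Round [i] adds [1 + eps - eps * y] of urgent work; the sizes [y] telescope to [g ^+ i * S - S].
   Sizes at least 1 keep every deadline at or after [1 + eps]. *)
have adv i : exists ps : seq R,
    [/\ forall p, p \in ps -> 1 <= p,
        ALG alg (tight ps) = g ^+ i * S &
        gain alg urgent (tight ps) = S + i%:R * (1 + eps) - eps * (g ^+ i * S - S)].
  elim: i => [|i [ps [ps1 loadE urgentE]]].
    exists (nseq K 1); split=> [p||].
    - by rewrite mem_nseq => /andP[_ /eqP ->].
    - by rewrite expr0 mul1r.
    - rewrite expr0 mul1r subrr mulr0 mul0r !addr0 subr0.
      apply: eq_bigr => j _; have [p + ->] := job_at_tight _ _ _ j.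
      by rewrite mem_nseq /urgent /= => /andP[_ /eqP ->]; rewrite mulr1 subrr subr0.
  pose y := (g - 1) * (g ^+ i * S).
  have y1 : 1 <= y.
    rewrite /y mulrCA; apply: le_trans (ltW gS) _.
    by rewrite ler_peMl ?exprn_ege1 // mulr_ge0 ?subr_ge0 // ltW.
  have gi0 : 0 < g ^+ i * S by rewrite mulr_gt0 // exprn_gt0 // (lt_le_trans ltr01).
  have [|||n nE] := @forced_acceptance _ _ _ _ _ y _ ps (ltW eps0) Km comp.
  - by move=> p /ps1; exact: lt_le_trans.
  - exact: lt_le_trans y1.
  (* This is [c < K * (g - 1)] multiplied by the current load. *)
  - by rewrite loadE /y [ltRHS]mulrA ltr_pM2r.
  exists (ps ++ nseq n.+1 y); split=> [p||].
  - rewrite mem_cat => /orP[/ps1 //|]; by rewrite mem_nseq => /andP[_ /eqP ->].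
  - by rewrite /ALG /load -/(gain _ _ _) nE -[gain _ _ _]/(ALG _ _) loadE exprS /= /y; lra.
  - rewrite nE urgentE exprS /urgent /= -natr1.
    by rewrite /y; lra.
have [ps [ps1 _ urgentE]] := adv m.
have ps0 p : p \in ps -> 0 < p by move=> /ps1; exact: lt_le_trans.
have := work_before_le _ _ _ _ _ (1 + eps) (meets _ (instance_tight _ eps _ ps0)).
rewrite -[X in _ -> _ -> _ -> X <= _]/(gain alg urgent _) urgentE => work.
have : S + m%:R * (1 + eps) - eps * (g ^+ m * S - S) <= m%:R * (1 + eps).
  apply: work => [|j _|j _]; first by lra.
  - by have [p _ ->] := job_at_tight _ _ _ j.
  - have [p /ps1 p1 ->] := job_at_tight _ _ _ j; rewrite /= ler_peMr //; lra.
have : eps * g ^+ m * S < (1 + eps) * S by rewrite ltr_pM2r.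
lra.
Qed.

(** * The closed form and the choice of the growth factor *)

Theorem theorem3 (R : realType) (m : nat) (eps : R) (hm : (1 <= m)%N)
    (heps0 : 0 < eps) (heps1 : eps <= 1) :
  (Num.floor (m%:R * (1 + eps)))%:~R
      / (eps * \sum_(0 <= i < m) ((1 + eps) / eps) `^ (i%:R / m%:R))
    = (Num.floor (m%:R * (1 + eps)))%:~R
      * (((1 + eps) / eps) `^ (1 / m%:R) - 1)
  /\
  (forall (alg : online_algorithm R m) (c : R),
     meets_commitments eps alg ->
     strictly_competitive eps alg c ->
     (Num.floor (m%:R * (1 + eps)))%:~R
       / (eps * \sum_(0 <= i < m) ((1 + eps) / eps) `^ (i%:R / m%:R))
     <= c).
Proof.
set b := (1 + eps) / eps; set f := b `^ (1 / m%:R).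
have b1 : 1 < b by rewrite /b ltr_pdivlMr // mul1r ltrDr.
have b0 : 0 <= b by rewrite ltW // (lt_trans ltr01).
have m0 : m%:R != 0 :> R by rewrite pnatr_eq0 -lt0n.
have f0 : 0 <= f := powR_ge0 _ _.
have powf i : b `^ (i%:R / m%:R) = f ^+ i.
  by rewrite -powR_mulrn // -powRrM mul1r mulrC.
have fm : f ^+ m = b by rewrite -powf divff // powRr1.
have f1 : 1 < f.
  by rewrite ltNge; apply/negP => fle1; move: b1; rewrite -fm ltNge exprn_ile1.
(* Geometric sum: [f - 1] times the sum of the [f ^+ i] is [f ^+ m - 1 = b - 1 = 1 / eps]. *)
have -> : eps * \sum_(0 <= i < m) b `^ (i%:R / m%:R) = (f - 1)^-1.
  have f10 : f - 1 != 0 by rewrite subr_eq0 gt_eqF.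
  under eq_bigr do rewrite powf.
  apply: (mulfI f10); rewrite divff // mulrCA big_mkord -subrX1 fm /b.
  by rewrite mulrBr mulrCA divff ?gt_eqF //; lra.
rewrite invrK; split=> // alg c meets comp.
have [K KE] : exists K : nat, Num.floor (m%:R * (1 + eps)) = K%:Z.
  exists `|Num.floor (m%:R * (1 + eps))|%N; rewrite gez0_abs // floor_ge0.
  by rewrite mulr_ge0 //; lra.
have K0 : (0 < K)%N.
  rewrite -ltz_nat -KE floor_gt0; apply: (@le_trans _ _ (m%:R * 1)).
    by rewrite mulr1 ler1n.
  by rewrite ler_wpM2l //; lra.
have Km : K%:R <= m%:R * (1 + eps).
  by have := floor_le (m%:R * (1 + eps)); rewrite KE.
have KR0 : 0 < K%:R :> R by rewrite ltr0n.
rewrite KE leNgt; apply/negP => cK.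
(* The maximum with 0 covers negative [c] and ensures [g >= 1] below. *)
pose d := Num.max c 0 / K%:R.
have d0 : 0 <= d by rewrite divr_ge0 ?(ltW KR0) // le_max lexx orbT.
have df : d < f - 1.
  by rewrite /d ltr_pdivrMr // mulrC gt_max cK mulr_gt0 // subr_gt0.
have cd : c <= K%:R * d by rewrite /d mulrC divfK ?gt_eqF // le_max lexx.
(* The midpoint of [1 + d] and [f]: strictly above the first for [c < K * (g - 1)], strictly below
   the second for [eps * g ^+ m < 1 + eps]. *)
pose g := 1 + (d + (f - 1)) / 2.
apply: (@adversary _ m K eps c g alg) => //; rewrite /g.
- lra.
- rewrite -(@divfK _ eps _ (1 + eps)) ?gt_eqF // mulrC ltr_pM2r // -/b -fm.
  by rewrite ltr_pXn2r // ?nnegrE //; lra.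
- by apply: le_lt_trans cd _; rewrite ltr_pM2l //; lra.
Qed.
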